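(* Let $n\in\mathbb{N}$, let $x_k>0$ for $1\le k\le n$, and let $p_k\ge0$ for $1\le k\le n$ satisfy $\sum_{k=1}^np_k=1$. Let $\alpha,\beta\in\mathbb{R}$. If either $\beta>0$ and $\alpha\le0$, or $\beta\ge1$ and $\alpha\le\frac12$, then $$\frac{\prod_{k=1}^n[\Gamma(x_k+\beta)]^{p_k}}{\Gamma\bigl(\sum_{k=1}^np_kx_k+\beta\bigr)}\ge\frac{\prod_{k=1}^nx_k^{p_k(x_k+\beta-\alpha)}}{\bigl(\sum_{k=1}^np_kx_k\bigr)^{\sum_{k=1}^np_kx_k+\beta-\alpha}}.$$ If $\alpha\ge\beta\ge\frac12$, then the reversed inequality holds, that is, $$\frac{\prod_{k=1}^n[\Gamma(x_k+\beta)]^{p_k}}{\Gamma\bigl(\sum_{k=1}^np_kx_k+\beta\bigr)}\le\frac{\prod_{k=1}^nx_k^{p_k(x_k+\beta-\alpha)}}{\bigl(\sum_{k=1}^np_kx_k\bigr)^{\sum_{k=1}^np_kx_k+\beta-\alpha}}.$$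
   Context: $\Gamma$ denotes the classical Euler gamma function, $\Gamma(x)=\int_0^\infty t^{x-1}e^{-t}\,dt$ for $x>0$, and $\mathbb{N}=\{1,2,3,\dots\}$. *)

(* Defs.v *)
From HB Require Import structures.
From mathcomp Require Import all_boot all_order all_algebra.
From mathcomp Require Import all_classical all_reals all_analysis.

Set Implicit Arguments.
Unset Strict Implicit.
Unset Printing Implicit Defensive.

Import Order.TTheory GRing.Theory Num.Theory.
Import numFieldNormedType.Exports.

Local Open Scope classical_set_scope.
Local Open Scope ring_scope.

(* Meaningful for [0 < x] only: for [x <= 0] the extended-real integral is
   [+oo], so that [Rintegral] returns the junk value [0]. *)
Definition Gamma (R : realType) (x : R) : R :=
  (\int[@lebesgue_measure R]_(t in `]0%R, +oo[) (t `^ (x - 1) * expR (- t)))%R.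

(* Main.v *)
(* Put c = beta - alpha and F(t) = ln Gamma(t + beta) - (t + c) ln t.  Taking
   logarithms, the claim is that F is convex (resp. concave) on t > 0, in the
   form of Jensen's inequality.  The functional equation gives
     F(t) - F(t + 1) = - ln(t + beta) - (t + c) ln t + (t + 1 + c) ln(t + 1),
   an elementary function whose second derivative is rational and has the right
   sign.  Moreover F(t + N) is, up to o(1) as N -> oo, an affine function of t:
   log-convexity and the functional equation squeeze
   ln Gamma(u + t) - ln Gamma(u) between t ln(u - 1) and t ln(u + t).
   Summing the Jensen gaps of F(. + k) - F(. + k + 1) over k < N and letting
   N -> oo gives the Jensen inequality for F, without digamma or Stirling. *)

Require Import Defs.
From HB Require Import structures.
From mathcomp Require Import all_boot all_order all_algebra.
From mathcomp Require Import all_classical all_reals all_analysis.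
From mathcomp Require Import measurable_realfun ring lra.

Set Implicit Arguments.
Unset Strict Implicit.
Unset Printing Implicit Defensive.

Import Order.TTheory GRing.Theory Num.Theory.
Import numFieldNormedType.Exports.

Local Open Scope ring_scope.
Local Open Scope classical_set_scope.

(** * Convexity on the positive axis and Jensen gaps *)

(** Two uses of the mean value theorem: applied to [f1] it makes [f1] nondecreasing, applied to [f]
    it turns the secant slope between [m] and [t] into a value of [f1] at an intermediate point,
    which is then compared with [f1 m]. *)
Lemma le_tangent (R : realType) (f f1 f2 : R -> R) :
  (forall t : R, 0 < t -> is_derive t 1 f (f1 t)) ->
  (forall t : R, 0 < t -> is_derive t 1 f1 (f2 t)) ->
  (forall t : R, 0 < t -> 0 <= f2 t) ->
  forall m t : R, 0 < m -> 0 < t -> f m + f1 m * (t - m) <= f t.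
Proof.
move=> df df1 f2_ge0.
have MVTpos (g g1 : R -> R) : (forall t : R, 0 < t -> is_derive t 1 g (g1 t)) ->
    forall a b : R, 0 < a -> a < b ->
    exists2 c, a < c < b & g b - g a = g1 c * (b - a).
  move=> dg a b a0 ab.
  have [||c + ->] := @MVT R g g1 a b ab.
  - by move=> t; rewrite in_itv/= => /andP[/(lt_trans a0) t0 _]; exact: dg.
  - apply: derivable_within_continuous => t; rewrite in_itv/= => /andP[at_ _].
    by have [] := dg _ (lt_le_trans a0 at_).
  by rewrite in_itv/=; exists c.
have f1_mono a b : 0 < a -> a < b -> f1 a <= f1 b.
  move=> a0 ab; have [c /andP[ac _] e] := MVTpos _ _ df1 _ _ a0 ab.
  rewrite -subr_ge0 e mulr_ge0 ?subr_ge0 ?(ltW ab)//.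
  by rewrite f2_ge0// (lt_trans a0).
move=> m t m0 t0; have [mt|tm|->] := ltgtP m t; last by rewrite subrr mulr0 addr0.
- have [c /andP[mc ct] e] := MVTpos _ _ df _ _ m0 mt.
  by rewrite -lerBrDl e ler_wpM2r ?subr_ge0 ?(ltW mt)// f1_mono.
- have [c /andP[tc cm] e] := MVTpos _ _ df _ _ t0 tm.
  have : f1 c * (m - t) <= f1 m * (m - t).
    by rewrite ler_wpM2r ?subr_ge0 ?(ltW tm)// f1_mono// (lt_trans t0).
  by rewrite -e; lra.
Qed.

Section JensenGap.
Context {R : realType} (n : nat) (x p : 'I_n -> R).

(** As a functional of [f] the gap is linear and kills affine functions, so convexity becomes a sign
    condition that can be summed and passed to the limit. *)
Definition jensen_gap (f : R -> R) : R :=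
  \sum_(k < n) p k * f (x k) - f (\sum_(k < n) p k * x k).

End JensenGap.

Section JensenTheory.
Context {R : realType} (n : nat) (p : 'I_n -> R).
Hypothesis p_ge0 : forall k, 0 <= p k.
Hypothesis sum_p : \sum_(k < n) p k = 1.
Implicit Types (x : 'I_n -> R) (f g : R -> R).

Lemma sum_pM_cst (a : R) : \sum_(k < n) p k * a = a.
Proof. by rewrite -mulr_suml sum_p mul1r. Qed.

Lemma mean_gt0 x : (forall k, 0 < x k) -> 0 < \sum_(k < n) p k * x k.
Proof.
move=> x0; rewrite lt_neqAle sumr_ge0 ?andbT; last first.
  by move=> k _; rewrite mulr_ge0// ltW.
apply/eqP => /esym/eqP; rewrite psumr_eq0; last first.
  by move=> k _; rewrite mulr_ge0// ltW.
move=> /allP px0; have := oner_neq0 R; rewrite -sum_p big1 ?eqxx// => k _.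
have := px0 k (mem_index_enum k).
by rewrite /= mulf_eq0 (gt_eqF (x0 k)) orbF => /eqP.
Qed.

Lemma eq_jensen_gap x f g : (forall k, 0 < x k) ->
  (forall t, 0 < t -> f t = g t) -> jensen_gap x p f = jensen_gap x p g.
Proof.
move=> x0 fg; rewrite /jensen_gap fg ?mean_gt0//.
by congr (_ - _); apply: eq_bigr => k _; rewrite fg.
Qed.

Lemma jensen_gapD x f g :
  jensen_gap x p (fun t => f t + g t) = jensen_gap x p f + jensen_gap x p g.
Proof.
rewrite /jensen_gap; under eq_bigr do rewrite mulrDr.
by rewrite big_split/=; ring.
Qed.

Lemma jensen_gapN x f : jensen_gap x p (fun t => - f t) = - jensen_gap x p f.
Proof.
rewrite /jensen_gap; under eq_bigr do rewrite mulrN.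
by rewrite sumrN; ring.
Qed.

Lemma jensen_gap_affine x (a b : R) : jensen_gap x p (fun t => a + b * t) = 0.
Proof.
rewrite /jensen_gap; under eq_bigr do rewrite mulrDr mulrCA.
by rewrite big_split/= sum_pM_cst -mulr_sumr subrr.
Qed.

Lemma jensen_gap_shift x f (c : R) :
  jensen_gap x p (fun t => f (t + c)) = jensen_gap (fun k => x k + c) p f.
Proof.
rewrite /jensen_gap; congr (_ - f _).
by under [RHS]eq_bigr do rewrite mulrDr; rewrite big_split/= sum_pM_cst.
Qed.

(** The tangent at the mean [m] is affine, so its gap is zero; [f] lies above it at every [x k] and
    meets it at [m]. *)
Lemma jensen_gap_ge0 x (f f1 f2 : R -> R) :
  (forall t : R, 0 < t -> is_derive t 1 f (f1 t)) ->
  (forall t : R, 0 < t -> is_derive t 1 f1 (f2 t)) ->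
  (forall t : R, 0 < t -> 0 <= f2 t) ->
  (forall k, 0 < x k) -> 0 <= jensen_gap x p f.
Proof.
move=> df df1 f2_ge0 x0; set m := \sum_(k < n) p k * x k.
have tangent := le_tangent df df1 f2_ge0 (mean_gt0 x0).
rewrite -(jensen_gap_affine x (f m - f1 m * m) (f1 m)) /jensen_gap -/m.
have -> : f m - f1 m * m + f1 m * m = f m by rewrite subrK.
rewrite lerB// ler_sum// => k _; rewrite ler_wpM2l//.
by rewrite (le_trans _ (tangent _ (x0 k)))// -/m; lra.
Qed.

(** The gap involves finitely many values of [u N], so pointwise convergence suffices. *)
Lemma cvg_jensen_gap x (u : nat -> R -> R) : (forall k, 0 < x k) ->
  (forall t : R, 0 < t -> u N t @[N --> \oo] --> 0) ->
  jensen_gap x p (u N) @[N --> \oo] --> 0.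
Proof.
move=> x0 u0; rewrite -[X in _ --> X]subr0.
apply: cvgB; last exact/u0/mean_gt0.
rewrite -[X in _ --> X](_ : \sum_(k < n) p k * 0 = 0); last first.
  by rewrite big1// => k _; rewrite mulr0.
by apply: cvg_big => [|k _]; [exact: add_continuous|apply: cvgMr; exact: u0].
Qed.

(* Convexity propagates backwards along the difference equation
   [f t = f (t + 1) + (convex function)], starting from asymptotic affinity. *)
Lemma jensen_gap_ge0_telescope x (f : R -> R) (a b : nat -> R) :
  (forall y, (forall k, 0 < y k) ->
    0 <= jensen_gap y p (fun t => f t - f (t + 1))) ->
  (forall t : R, 0 < t -> f (t + N%:R) - (a N + b N * t) @[N --> \oo] --> 0) ->
  (forall k, 0 < x k) -> 0 <= jensen_gap x p f.
Proof.
move=> step faff x0.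
(* Each further unit shift can only lower the gap, by [step] at the points [x k + N%:R]. *)
have gapN N : jensen_gap x p (fun t => f (t + N%:R)) <= jensen_gap x p f.
  elim: N => [|N ih]; first by under [fun _ => _]funext do rewrite addr0.
  apply: le_trans ih; rewrite -subr_ge0 -jensen_gapN -jensen_gapD.
  have := step (fun k => x k + N%:R).
  rewrite -(jensen_gap_shift x (fun t => f t - f (t + 1))).
  under [fun t => _ - _]funext do rewrite -addrA (addrC _ 1) nat1r.
  by apply => k; rewrite ltr_wpDr.
(* Subtracting the affine part does not change the gap, so the gaps of the shifted functions tend to
   0 while staying below the gap of [f]. *)
have := cvg_jensen_gap x0 faff.
move=> /cvgP/limr_le => /(_ (jensen_gap x p f)).
rewrite (cvg_lim _ (cvg_jensen_gap x0 faff))//; apply; apply: nearW => N.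
rewrite jensen_gapD jensen_gapN jensen_gap_affine subr0.
exact: gapN.
Qed.

End JensenTheory.

(** * Elementary limits of shifted ratios and logarithms *)

Section Asymptotics.
Context {R : realType}.
Implicit Types a b t u : R.

Lemma near_shift_gt0 a : \forall N \near \oo, 0 < N%:R + a.
Proof.
near=> N; rewrite -ltrBlDr sub0r.
by near: N; exact: nbhs_infty_gtr.
Unshelve. all: by end_near. Qed.

Lemma cvg_shift_ratio a b :
  (N%:R + a) / (N%:R + b) @[N --> \oo] --> (1 : R).
Proof.
have lim : 1 + (a - b) * (N%:R + b)^-1 @[N --> \oo] --> (1 : R).
  rewrite -[X in _ --> X]addr0 -[X in _ --> _ + X](mulr0 (a - b)).
  apply: cvgD; first exact: cvg_cst.
  apply: cvgMr.
  apply/(gtr0_cvgV0 (f := fun N => N%:R + b) (near_shift_gt0 b)).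
  exact: (cvg_comp _ _ cvgr_idn (cvg_addrr b)).
apply: cvg_trans lim; apply: near_eq_cvg; near=> N.
have : 0 < N%:R + b by near: N; exact: near_shift_gt0.
by move=> /gt_eqF/negbT ?; field.
Unshelve. all: by end_near. Qed.

Lemma cvg_ln_shift_ratio a b :
  ln ((N%:R + a) / (N%:R + b)) @[N --> \oo] --> (0 : R).
Proof.
rewrite -(@ln1 R); apply: continuous_cvg; last exact: cvg_shift_ratio.
exact: continuous_ln.
Qed.

Lemma ln_le_subr1 t : 0 < t -> ln t <= t - 1.
Proof. by move=> t0; have := @le_ln1Dx R (t - 1); rewrite subrKC; apply; lra. Qed.

Lemma ln_ge_1subV t : 0 < t -> 1 - t^-1 <= ln t.
Proof.
move=> t0; rewrite -lerN2 -lnV ?posrE// opprB.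
by rewrite ln_le_subr1 ?invr_gt0.
Qed.

(** With r = (N + t) / N, the bounds 1 - 1/r <= ln r <= r - 1 read t / (N + t) <= ln r <= t / N. The
    [+ 0] in the upper bound gives it the shape of [cvg_shift_ratio]. *)
Lemma cvg_shiftM_ln a t : 0 < t ->
  (N%:R + a) * ln ((N%:R + t) / N%:R) @[N --> \oo] --> t.
Proof.
move=> t0.
apply: (@squeeze_cvgr _ _ _ _ (fun N : nat => t * ((N%:R + a) / (N%:R + t)))
  (fun N : nat => t * ((N%:R + a) / (N%:R + 0)))).
- near=> N.
  have N0 : 0 < N%:R :> R.
    by rewrite -[N%:R]addr0; near: N; exact: near_shift_gt0.
  have Na0 : 0 < N%:R + a by near: N; exact: near_shift_gt0.
  have r0 : 0 < (N%:R + t) / N%:R by rewrite divr_gt0// addr_gt0.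
  apply/andP; split.
    rewrite mulrCA ler_wpM2l ?(ltW Na0)//.
    rewrite (le_trans _ (ln_ge_1subV r0))// le_eqVlt; apply/orP; left.
    by apply/eqP; field; rewrite !gt_eqF// addr_gt0.
  rewrite mulrCA ler_wpM2l ?(ltW Na0)//.
  rewrite (le_trans (ln_le_subr1 r0))// le_eqVlt; apply/orP; left.
  by apply/eqP; field; rewrite !gt_eqF// ?addr0.
- rewrite -[X in _ --> X]mulr1; apply: cvgMr; exact: cvg_shift_ratio.
- rewrite -[X in _ --> X]mulr1; apply: cvgMr; exact: cvg_shift_ratio.
Unshelve. all: by end_near. Qed.

(** * Growth of convex solutions of L(t + 1) = L(t) + ln t *)

Section LogConvex.
Variable L : R -> R.
Hypothesis L_step : forall t : R, 0 < t -> L (t + 1) = L t + ln t.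
Hypothesis L_convex : forall s a b : R, 0 <= s <= 1 -> 0 < a -> 0 < b ->
  L (s * a + (1 - s) * b) <= s * L a + (1 - s) * L b.

(* The slope of [L] on [u, u + t] is at most its slope on [u + t, u + t + 1]. *)
Lemma log_convex_increment_le u t : 0 < u -> 0 < t ->
  L (u + t) - L u <= t * ln (u + t).
Proof.
move=> u0 t0; have t1 : 0 < t + 1 by rewrite ltr_wpDl// ltW.
have : L (u + t) <= (t + 1)^-1 * L u + (1 - (t + 1)^-1) * L (u + t + 1).
  (* The weight 1 / (t + 1) is the one that places [u + t] between [u] and [u + t + 1]. *)
  have -> : u + t = (t + 1)^-1 * u + (1 - (t + 1)^-1) * (u + t + 1).
    by field; rewrite gt_eqF.
  rewrite [in X in _ <= X](_ : (t + 1)^-1 * u + _ = u + t); last first.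
    by field; rewrite gt_eqF.
  apply: L_convex => //; last by rewrite !addr_gt0.
  by rewrite invr_ge0 ltW//= invf_le1// lerDr ltW.
rewrite L_step ?addr_gt0// -(ler_pM2l t1).
have -> : (t + 1) * ((t + 1)^-1 * L u + (1 - (t + 1)^-1) * (L (u + t) + ln (u + t)))
   = L u + t * (L (u + t) + ln (u + t)) by field; rewrite gt_eqF.
lra.
Qed.

(* The slope of [L] on [u, u + t] is at least its slope on [u - 1, u]. *)
Lemma log_convex_increment_ge u t : 1 < u -> 0 < t ->
  t * ln (u - 1) <= L (u + t) - L u.
Proof.
move=> u1 t0; have t1 : 0 < t + 1 by rewrite ltr_wpDl// ltW.
have um0 : 0 < u - 1 by rewrite subr_gt0.
have := @L_convex (t / (t + 1)) (u - 1) (u + t).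
have -> : t / (t + 1) * (u - 1) + (1 - t / (t + 1)) * (u + t) = u.
  by field; rewrite gt_eqF.
have <- : L (u - 1) + ln (u - 1) = L u by rewrite -L_step// subrK.
move=> /(_ _ um0 _).
rewrite divr_ge0 ?(ltW t0) ?(ltW t1)//= ler_pdivrMr// mul1r lerDl ler01.
move=> /(_ isT); rewrite addr_gt0// ?(lt_trans ltr01)// => /(_ isT).
rewrite -(ler_pM2l t1).
have -> : (t + 1) * (t / (t + 1) * L (u - 1) + (1 - t / (t + 1)) * L (u + t))
   = t * L (u - 1) + L (u + t) by field; rewrite gt_eqF.
lra.
Qed.

(** The two slope bounds at u = N + b, less t ln N, are t times logarithms of ratios tending to
    1. *)
Lemma cvg_log_convex_increment b t : 0 < t ->
  L (t + N%:R + b) - L (N%:R + b) - t * ln N%:R @[N --> \oo] --> 0.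
Proof.
move=> t0.
apply: (@squeeze_cvgr _ _ _ _
  (fun N : nat => t * ln ((N%:R + (b - 1)) / (N%:R + 0)))
  (fun N : nat => t * ln ((N%:R + (b + t)) / (N%:R + 0)))).
- near=> N.
  have N0 : 0 < N%:R :> R.
    by rewrite -[N%:R]addr0; near: N; exact: near_shift_gt0.
  have Nb0 : 0 < N%:R + (b - 1) by near: N; exact: near_shift_gt0.
  have Nbt0 : 0 < N%:R + (b + t) by rewrite addrA; lra.
  have u1 : 1 < N%:R + b by lra.
  have u0 : 0 < N%:R + b by lra.
  rewrite !addr0 !ln_div ?posrE// !mulrBr !lerD2r.
  have := log_convex_increment_ge u1 t0; have := log_convex_increment_le u0 t0.
  have -> : t + N%:R + b = N%:R + b + t by ring.
  by rewrite !addrA => -> ->.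
- rewrite -[X in _ --> X](mulr0 t); apply: cvgMr; exact: cvg_ln_shift_ratio.
- rewrite -[X in _ --> X](mulr0 t); apply: cvgMr; exact: cvg_ln_shift_ratio.
Unshelve. all: by end_near. Qed.

(** Expand ln(t + N) as ln N + ln((N + t) / N). The terms t ln N cancel against the growth of [L],
    and (N + t + c) ln((N + t) / N) tends to t, whence the slope -1. *)
Lemma cvg_log_convex_affine b c t : 0 < t ->
  L (t + N%:R + b) - (t + N%:R + c) * ln (t + N%:R)
    - ((L (N%:R + b) - (N%:R + c) * ln N%:R) + (- 1) * t) @[N --> \oo] --> 0.
Proof.
move=> t0.
have lim : L (t + N%:R + b) - L (N%:R + b) - t * ln N%:R
    - ((N%:R + (t + c)) * ln ((N%:R + t) / N%:R) - t) @[N --> \oo] --> 0.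
  rewrite -[X in _ --> X](subrr 0); apply: cvgB.
    exact: cvg_log_convex_increment.
  rewrite -[X in _ --> X](subrr t); apply: cvgB; last exact: cvg_cst.
  exact: cvg_shiftM_ln.
apply: cvg_trans lim; apply: near_eq_cvg; near=> N.
have N0 : 0 < N%:R :> R.
  by rewrite -[N%:R]addr0; near: N; exact: near_shift_gt0.
rewrite ln_div ?posrE// ?addr_gt0// (addrC N%:R t); ring.
Unshelve. all: by end_near. Qed.

End LogConvex.
End Asymptotics.

(** * The elementary difference F(t) - F(t + 1) and the sign of its second derivative *)

Section GammaStep.
Context {R : realType} (b c : R).

Lemma is_derive_lnD (a t : R) : 0 < t + a ->
  is_derive t 1 (fun t => ln (t + a)) (t + a)^-1.
Proof.
move=> ta; rewrite -[(t + a)^-1]mulr1.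
apply: (@is_derive1_comp _ (@ln R) (fun t => t + a)).
  exact: is_derive1_ln.
by apply: is_derive_eq; rewrite addr0.
Qed.

Lemma is_derive_VD (a t : R) : 0 < t + a ->
  is_derive t 1 (fun t => (t + a)^-1) (- (t + a) ^- 2).
Proof.
move=> ta; rewrite -[X in is_derive _ _ _ X]mulr1.
apply: (@is_deriveV R (fun t => t + a)); first by rewrite gt_eqF.
by apply: is_derive_eq; rewrite addr0.
Qed.

Definition gamma_step (t : R) :=
  - ln (t + b) - (t + c) * ln t + (t + 1 + c) * ln (t + 1).

Definition gamma_step1 (t : R) :=
  - (t + b)^-1 - ln t - c * t^-1 + ln (t + 1) + c * (t + 1)^-1.

Definition gamma_step2 (t : R) :=
  (t + b) ^- 2 - t^-1 + (t + 1)^-1 + c * t ^- 2 - c * (t + 1) ^- 2.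

Lemma is_derive_gamma_step (t : R) : 0 < t -> 0 < t + b ->
  is_derive t 1 gamma_step (gamma_step1 t).
Proof.
move=> t0 tb0; have t1 : 0 < t + 1 by rewrite addr_gt0.
have h1 := is_derive1_ln t0.
have h2 := is_derive_lnD tb0.
have h3 := is_derive_lnD t1.
apply: is_derive_eq.
rewrite /gamma_step1 /GRing.scale/=.
by field; rewrite !gt_eqF.
Qed.

Lemma is_derive_gamma_step1 (t : R) : 0 < t -> 0 < t + b ->
  is_derive t 1 gamma_step1 (gamma_step2 t).
Proof.
move=> t0 tb0; have t1 : 0 < t + 1 by rewrite addr_gt0.
have h1 := is_derive1_ln t0.
have h2 := is_derive_VD tb0.
have h3 := is_derive_lnD t1.
have h4 := is_derive_VD t1.
have h5 : is_derive t 1 (fun t => t^-1) (- t ^- 2).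
  rewrite -[X in is_derive _ _ _ X]mulr1.
  by apply: (@is_deriveV R id); rewrite gt_eqF.
apply: is_derive_eq.
rewrite /gamma_step2 /GRing.scale/=.
by field; rewrite !gt_eqF.
Qed.

End GammaStep.

(** Over the positive common denominator the numerator is nonincreasing in [a], so only the extreme
    values a = 0 and a = 1/2 matter. There it is a polynomial in [t] with nonnegative
    coefficients. *)
Lemma gamma_step2_ge0 {R : realType} (a b t : R) :
  0 < b /\ a <= 0 \/ 1 <= b /\ a <= 2^-1 ->
  0 < t -> 0 <= gamma_step2 b (b - a) t.
Proof.
move=> hab t0; have b0 : 0 < b by case: hab => -[]; lra.
have h2 : 2^-1 = 1 / 2 :> R by lra.
have tb0 : 0 < t + b by lra.
have t10 : 0 < t + 1 by lra.
have -> : gamma_step2 b (b - a) t =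
  (t ^+ 2 * (t + 1) ^+ 2 - t * (t + 1) * (t + b) ^+ 2
    + (b - a) * (2 * t + 1) * (t + b) ^+ 2)
  / (t ^+ 2 * (t + 1) ^+ 2 * (t + b) ^+ 2).
  by rewrite /gamma_step2; field; rewrite !gt_eqF.
apply: divr_ge0; last first.
  by rewrite -!exprMn sqr_ge0.
have mono (a' : R) : a <= a' -> (b - a') * (2 * t + 1) * (t + b) ^+ 2
    <= (b - a) * (2 * t + 1) * (t + b) ^+ 2.
  move=> aa'; rewrite -!mulrA; apply: ler_wpM2r; last by lra.
  by apply: mulr_ge0; [lra|exact: sqr_ge0].
case: hab => -[hb ha].
- have e : t ^+ 2 * (t + 1) ^+ 2 - t * (t + 1) * (t + b) ^+ 2
    + (b - 0) * (2 * t + 1) * (t + b) ^+ 2 =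
    t ^+ 3 + t ^+ 2 * (1 - b + 3 * b ^+ 2) + t * (b ^+ 2 + 2 * b ^+ 3) + b ^+ 3.
    by ring.
  rewrite (le_trans _ (lerD (lexx _) (mono _ ha)))// e.
  (* Completing the square: 1 - b + 3 b^2 = 3 (b - 1/6)^2 + 11/12. *)
  have q0 : 0 <= 1 - b + 3 * b ^+ 2 by have := sqr_ge0 (b - 1 / 6); lra.
  have [t0' b0'] := (ltW t0, ltW b0).
  apply: addr_ge0; last exact: exprn_ge0.
  apply: addr_ge0; last first.
    by apply: mulr_ge0 => //; rewrite addr_ge0 ?mulr_ge0 ?exprn_ge0.
  by apply: addr_ge0; rewrite ?mulr_ge0 ?exprn_ge0.
- rewrite h2 in ha.
  (* At a = 1/2 the cubic terms cancel as well, and b >= 1 makes the remaining coefficients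
     nonnegative. *)
  have e : t ^+ 2 * (t + 1) ^+ 2 - t * (t + 1) * (t + b) ^+ 2
    + (b - 1 / 2) * (2 * t + 1) * (t + b) ^+ 2 =
    t ^+ 2 * (1 / 2 + 3 * b * (b - 1)) + t * (b * (2 * b ^+ 2 - 1))
    + b ^+ 2 * (b - 1 / 2) by field.
  rewrite (le_trans _ (lerD (lexx _) (mono _ ha)))// e.
  have b2 : 1 <= b ^+ 2 by rewrite exprn_ege1.
  apply: addr_ge0; last by apply: mulr_ge0; [exact: sqr_ge0|lra].
  apply: addr_ge0; apply: mulr_ge0; [exact: sqr_ge0| |exact: ltW|].
    by rewrite addr_ge0 ?mulr_ge0//; lra.
  by apply: mulr_ge0; lra.
Qed.

(** Here (t + b)^2 - t (t + 1) = (2 b - 1) t + b^2, nonnegative for b >= 1/2, and the term carrying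
    a - b has the same sign. *)
Lemma gamma_step2_le0 {R : realType} (a b t : R) : b <= a -> 2^-1 <= b ->
  0 < t -> gamma_step2 b (b - a) t <= 0.
Proof.
move=> ab hb t0.
have h2 : 2^-1 = 1 / 2 :> R by lra.
rewrite h2 in hb.
have tb0 : 0 < t + b by lra.
have t10 : 0 < t + 1 by lra.
have -> : gamma_step2 b (b - a) t =
  - (t * (t + 1) * ((2 * b - 1) * t + b ^+ 2)
    + (a - b) * (2 * t + 1) * (t + b) ^+ 2)
  / (t ^+ 2 * (t + 1) ^+ 2 * (t + b) ^+ 2).
  by rewrite /gamma_step2; field; rewrite !gt_eqF.
rewrite mulNr oppr_le0; apply: divr_ge0; last first.
  by rewrite -!exprMn sqr_ge0.
have h : 0 <= (2 * b - 1) * t by apply: mulr_ge0; lra.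
apply: addr_ge0.
  by apply: mulr_ge0; [apply: mulr_ge0; lra|rewrite addr_ge0 ?sqr_ge0].
by apply: mulr_ge0; [apply: mulr_ge0; lra|exact: sqr_ge0].
Qed.

(** * The Gamma integral: functional equation, finiteness, positivity, log-convexity *)

Section GammaIntegral.
Context {R : realType}.
Notation mu := (@lebesgue_measure R).
Implicit Types x y t : R.

Definition gamma_integrand x t : R := t `^ (x - 1) * expR (- t).

(** Extended-real values let the functional equation be proved by monotone convergence before
    finiteness is known; finiteness is then deduced from it. *)
Definition eGamma x : \bar R :=
  (\int[mu]_(t in `]0%R, +oo[) (gamma_integrand x t)%:E)%E.

Lemma gamma_integrand_ge0 x t : 0 <= gamma_integrand x t.
Proof. by rewrite mulr_ge0 ?powR_ge0 ?expR_ge0. Qed.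

Lemma measurable_gamma_integrand x (D : set R) :
  measurable_fun D (fun t => gamma_integrand x t).
Proof.
apply: measurable_funTS; apply: measurable_funM; first exact: measurable_powR.
by apply: measurableT_comp => //; exact: oppr_measurable.
Qed.

Lemma measurable_gamma_integrandE x (D : set R) :
  measurable_fun D (fun t => (gamma_integrand x t)%:E).
Proof. by apply/measurable_EFinP; exact: measurable_gamma_integrand. Qed.

Lemma eGamma_ge0 x : (0 <= eGamma x)%E.
Proof. by apply: integral_ge0 => t _; rewrite lee_fin gamma_integrand_ge0. Qed.

Lemma continuous_expRN : continuous (fun t : R => expR (- t)).
Proof. by move=> t; apply: differentiable_continuous; apply/derivable1_diffP. Qed.

(** For t >= 1 and an integer m >= x, t^x t <= t^(m + 1) <= (m + 1)! e^t, so the product is at most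
    (m + 1)! / t. *)
Lemma cvg_powRM_expRN x : (t `^ x * expR (- t)) @[t --> +oo] --> 0.
Proof.
pose m := (Num.truncn x).+1.
have xm : x <= m%:R by apply/ltW/truncnS_gt.
apply: (@squeeze_cvgr _ _ _ _ (cst 0) (fun t => m.+1`!%:R * t^-1)).
- near=> t.
  have t1 : 1 <= t by near: t; exact: nbhs_pinfty_ge.
  have t0 : 0 < t by rewrite (lt_le_trans ltr01).
  rewrite mulr_ge0 ?powR_ge0 ?expR_ge0//=.
  rewrite expRN ler_pdivrMr ?expR_gt0// mulrAC ler_pdivlMr//.
  rewrite (le_trans (ler_wpM2r (ltW t0) (ler_powR t1 xm)))//.
  rewrite powR_mulrn ?(ltW t0)// -exprSr -ler_pdivrMl ?ltr0n ?fact_gt0//.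
  rewrite mulrC; apply: le_trans (expR_ge1Dxn m (ltW t0)).
  by rewrite lerDr.
- exact: cvg_cst.
- rewrite -[X in _ --> X](mulr0 (m.+1`!%:R)); apply: cvgMr.
  by apply/(gtr0_cvgV0 (f := id)) => //; exact: nbhs_pinfty_gt.
Unshelve. all: by end_near. Qed.

Lemma itv0y_bigcup_cc :
  `]0, +oo[%classic = \bigcup_n `[(n.+1%:R)^-1, n.+1%:R : R]%classic.
Proof.
apply/seteqP; split => [t/=|t [n _]/=]; rewrite !in_itv/=.
(* This choice makes N + 1 exceed both t and 1 / t. *)
- rewrite andbT => t0; pose N := (Num.truncn t + Num.truncn t^-1)%N.
  exists N => //=; rewrite in_itv/=.
  apply/andP; split.
    rewrite invf_ple ?posrE// (le_trans (ltW (truncnS_gt _)))//.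
    by rewrite ler_nat ltnS leq_addl.
  by rewrite (le_trans (ltW (truncnS_gt _)))// ler_nat ltnS leq_addr.
- by rewrite andbT => /andP[+ _]; apply: lt_le_trans; rewrite invr_gt0.
Qed.

Lemma cvg_integral_itv0y (f : R -> R) :
  measurable_fun [set: R] f -> (forall t, 0 <= f t) ->
  (\int[mu]_(t in `[n.+1%:R^-1%R, n.+1%:R%R]) (f t)%:E)%E @[n --> \oo] -->
  (\int[mu]_(t in `]0%R, +oo[) (f t)%:E)%E.
Proof.
move=> mf f0; rewrite itv0y_bigcup_cc.
apply: ge0_nondecreasing_set_cvg_integral => //.
- apply/nondecreasing_seqP => n; apply/subsetPset => t/=; rewrite !in_itv/=.
  move=> /andP[nt tn]; apply/andP; split.
    by rewrite (le_trans _ nt)// lef_pV2 ?posrE// ler_nat.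
  by rewrite (le_trans tn)// ler_nat.
- by move=> n; apply/measurable_EFinP; exact: measurable_funTS.
- by move=> n t _; rewrite lee_fin.
Qed.

(** A compact interval inside the positive axis avoids the possible singularity at 0, so ordinary
    integration by parts applies to e^(-t) and t^x. *)
Lemma gamma_by_parts x (a b : R) : 0 <= x -> 0 < a -> a < b ->
  (x%:E * \int[mu]_(t in `[a, b]) (gamma_integrand x t)%:E =
   (b `^ x * expR (- b) - a `^ x * expR (- a))%:E +
   \int[mu]_(t in `[a, b]) (gamma_integrand (x + 1) t)%:E)%E.
Proof.
move=> x0 a0 ab.
have pos t : t \in `[a, b]%R -> 0 < t.
  by rewrite in_itv/= => /andP[/(lt_le_trans a0)].
have posoo t : t \in `]a, b[%R -> 0 < t.
  by move=> /subset_itv_oo_cc; exact: pos.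
have dexp t : is_derive t 1 (fun t => expR (- t)) (- expR (- t)).
  by apply: is_derive_eq; rewrite /GRing.scale/= mulrN1.
have cpow y t : 0 < t -> {for t, continuous (fun u : R => u `^ y)}.
  move=> t0; apply: differentiable_continuous; apply/derivable1_diffP.
  by apply: derivable_powR; rewrite in_itv/= t0.
have within (f : R -> R) : (forall t, 0 < t -> {for t, continuous f}) ->
    {within `[a, b], continuous f}.
  move=> cf; apply: continuous_in_subspaceT => t; rewrite inE => tab.
  by apply: cf; apply: pos.
have LR (f : R -> R) : (forall t, 0 < t -> derivable f t 1) ->
    derivable_oo_LRcontinuous f a b.
  move=> df; have cf t : 0 < t -> {for t, continuous f}.
    by move=> t0; apply: differentiable_continuous; apply/derivable1_diffP; exact: df.
  split.
  - by move=> t /posoo; exact: df.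
  - by apply: cvg_at_right_filter; apply: cf.
  - by apply: cvg_at_left_filter; apply: cf; rewrite (lt_trans a0).
rewrite -ge0_integralZl_EFin//; last 2 first.
- by move=> t _; rewrite lee_fin gamma_integrand_ge0.
- exact: measurable_gamma_integrandE.
under eq_integral do rewrite -EFinM /gamma_integrand mulrA mulrC.
rewrite (@integration_by_parts R (fun t => expR (- t)) (fun t => t `^ x)
   (fun t => - expR (- t)) (fun t => x * t `^ (x - 1)))//.
- rewrite !(mulrC (expR _)); congr (_ + _)%E.
  have -> : (\int[mu]_(t in `[a, b]) (- expR (- t) * t `^ x)%:E =
      \int[mu]_(t in `[a, b]) - (gamma_integrand (x + 1) t)%:E)%E.
    apply: eq_integral => t _.
    by rewrite /gamma_integrand addrK mulNr mulrC EFinN.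
  rewrite integral_ge0N ?oppeK// => t _.
  by rewrite lee_fin gamma_integrand_ge0.
- by apply: within => t _; apply: cvgN; exact: continuous_expRN.
- by apply: LR => t _; have [] := dexp t.
- by move=> t _; rewrite derive1E; have [_ ->] := dexp t.
- by apply: within => t t0; apply: cvgMr; exact: cpow.
- by apply: LR => t t0; apply: derivable_powR; rewrite in_itv/= t0.
- by move=> t /posoo t0; rewrite powR_derive1// in_itv/= t0.
Qed.

Lemma eGammaD1 x : 0 < x -> (eGamma (x + 1) = x%:E * eGamma x)%E.
Proof.
move=> x0.
have cvgI y := cvg_integral_itv0y (@measurable_gamma_integrand y setT)
  (gamma_integrand_ge0 y).
have cvgV : (n.+1%:R^-1 : R) @[n --> \oo] --> 0 by exact: cvg_harmonic.
have cvg_y : (n.+1%:R : R) @[n --> \oo] --> +oo.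
  by rewrite (cvg_shiftS (fun n => n%:R : R)); exact: cvgr_idn.
(* At the upper end the exponential wins; at the lower end t^x tends to 0 because x > 0. *)
have boundary : n.+1%:R `^ x * expR (- n.+1%:R)
    - n.+1%:R^-1 `^ x * expR (- n.+1%:R^-1) @[n --> \oo] --> (0 : R).
  rewrite -[X in _ --> X](subrr 0); apply: cvgB.
    exact: (cvg_comp _ _ cvg_y (cvg_powRM_expRN x)).
  rewrite -[X in _ --> X](mul0r (expR (- 0))); apply: cvgM.
    by apply: (cvg_at_rightP _ _ _).1 (powR_cvg0 x0) _ _; split.
  exact: (cvg_comp _ _ cvgV (@continuous_expRN 0)).
have lhs : (x%:E * \int[mu]_(t in `[n.+1%:R^-1%R, n.+1%:R%R])
    (gamma_integrand x t)%:E)%E @[n --> \oo] --> (x%:E * eGamma x)%E.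
  by apply: cvgeZl => //; exact: (cvgI x).
have rhs : ((n.+1%:R `^ x * expR (- n.+1%:R)
    - n.+1%:R^-1 `^ x * expR (- n.+1%:R^-1))%:E +
    \int[mu]_(t in `[n.+1%:R^-1%R, n.+1%:R%R]) (gamma_integrand (x + 1) t)%:E)%E
    @[n --> \oo] --> (0 + eGamma (x + 1))%E.
  apply: cvgeD; [exact: fin_num_adde_defr| |exact: (cvgI (x + 1))].
  by apply: cvg_EFin; [exact: nearW|exact: boundary].
rewrite -[LHS]add0e; apply/esym; apply: cvg_unique lhs _ => //.
apply: cvg_trans rhs; apply: near_eq_cvg; near=> n.
(* For n = 0 the interval is a single point, so n > 0 is needed to have distinct endpoints. *)
rewrite gamma_by_parts ?(ltW x0) ?invr_gt0// (@lt_trans _ _ 1)//.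
  rewrite invf_lt1// ltr1n ltnS; near: n; exact: nbhs_infty_gt.
rewrite ltr1n ltnS; near: n; exact: nbhs_infty_gt.
Unshelve. all: by end_near. Qed.

Lemma eGamma1_lty : (eGamma 1 < +oo)%E.
Proof.
have dNexp t : is_derive t 1 (fun t => - expR (- t)) (expR (- t)).
  by apply: is_derive_eq; rewrite /GRing.scale/= mulrN1 opprK.
rewrite /eGamma integral_itv_obnd_cbnd; last exact: measurable_gamma_integrandE.
under eq_integral do rewrite /gamma_integrand subrr powRr0 mul1r.
rewrite (@ge0_continuous_FTC2y R _ (fun t => - expR (- t)) 0 0).
- by rewrite -EFinB ltry.
- by move=> t _; exact: expR_ge0.
- apply: continuous_subspaceT; exact: continuous_expRN.
- by rewrite -[X in _ --> X]oppr0; apply: cvgN; exact: cvgr_expR.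
- by move=> t _; have [] := dNexp t.
- by apply: cvg_at_right_filter; apply: cvgN; exact: continuous_expRN.
- by move=> t _; rewrite derive1E; have [_ ->] := dNexp t.
Qed.

Lemma eGamma_natr_lty n : (eGamma n.+1%:R < +oo)%E.
Proof.
elim: n => [|n ih]; first exact: eGamma1_lty.
by rewrite -natr1 eGammaD1// lte_mul_pinfty// lee_fin.
Qed.

(** By the functional equation it is enough to treat x + 1, whose integrand carries t^x with x > 0.
    Splitting at t = 1 gives t^x <= 1 + t^(m + 1), which is dominated by the integrands at two
    positive integers. *)
Lemma eGamma_fin_num x : 0 < x -> eGamma x \is a fin_num.
Proof.
move=> x0; rewrite ge0_fin_numE ?eGamma_ge0//.
suff : (eGamma (x + 1) < +oo)%E.
  rewrite eGammaD1//; have := eGamma_ge0 x.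
  by case: (eGamma x) => [r _ _| |]//; rewrite ?ltry// gt0_muley ?lte_fin// ltxx.
pose m := Num.truncn x.
have xm : x <= m.+1%:R by apply/ltW/truncnS_gt.
have : (eGamma 1 + eGamma m.+2%:R < +oo)%E.
  by rewrite lte_add_pinfty ?eGamma1_lty ?eGamma_natr_lty.
apply: le_lt_trans.
rewrite /eGamma -ge0_integralD//=; last 4 first.
- by move=> t _; rewrite lee_fin gamma_integrand_ge0.
- exact: measurable_gamma_integrandE.
- by move=> t _; rewrite lee_fin gamma_integrand_ge0.
- exact: measurable_gamma_integrandE.
apply: ge0_le_integral => //.
- by move=> t _; rewrite lee_fin gamma_integrand_ge0.
- exact: measurable_gamma_integrandE.
- by apply: emeasurable_funD; exact: measurable_gamma_integrandE.
- move=> t; rewrite /= in_itv/= andbT => t0; rewrite -EFinD lee_fin.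
  rewrite /gamma_integrand addrK -[in m.+2%:R]natr1 addrK subrr powRr0 -mulrDl.
  rewrite ler_wpM2r ?expR_ge0//; have [t1|t1] := leP 1 t.
    by rewrite (le_trans (ler_powR t1 xm))// lerDr.
  rewrite (@le_trans _ _ 1) ?lerDl ?powR_ge0//.
  rewrite -(powRr0 t); apply: ger_powR; rewrite ?t0 ?(ltW t1)//; exact: ltW.
Qed.

Lemma EFin_Gamma x : 0 < x -> ((Gamma x)%:E = eGamma x)%E.
Proof. by move=> x0; rewrite /Gamma /Rintegral fineK//; exact: eGamma_fin_num. Qed.

Lemma GammaD1 x : 0 < x -> Gamma (x + 1) = x * Gamma x.
Proof.
move=> x0; apply: EFin_inj.
by rewrite EFinM !EFin_Gamma ?addr_gt0// eGammaD1.
Qed.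

(** After passing to x + 1, the power t^x is at least 1 on [1, 2], so the integrand is at least
    e^(-2) there. *)
Lemma Gamma_gt0 x : 0 < x -> 0 < Gamma x.
Proof.
move=> x0; rewrite -(pmulr_rgt0 _ x0) -GammaD1// -lte_fin EFin_Gamma ?addr_gt0//.
apply: (@lt_le_trans _ _ (\int[mu]_(t in `[1%R, 2%R]) (expR (- 2))%:E)%E).
  rewrite integral_cst//= lebesgue_measure_itv/= lte_fin ltr1n/= -EFinB -EFinM.
  by rewrite lte_fin mulr_gt0 ?expR_gt0//; lra.
have sub : `[1, 2 : R] `<=` `]0, +oo[.
  by move=> t/=; rewrite !in_itv/= andbT => /andP[+ _]; exact: lt_le_trans.
apply: (@le_trans _ _ (\int[mu]_(t in `[1%R, 2%R]) (gamma_integrand (x + 1) t)%:E)%E).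
  apply: ge0_le_integral => //.
  - exact: measurable_gamma_integrandE.
  move=> t; rewrite /= in_itv/= => /andP[t1 t2]; rewrite lee_fin.
  rewrite /gamma_integrand addrK -[leLHS]mul1r ler_pM ?expR_ge0//.
    by rewrite -(powRr0 t) ler_powR// ltW.
  by rewrite ler_expR lerN2.
apply: ge0_subset_integral => //; first exact: measurable_gamma_integrandE.
by move=> t _; rewrite lee_fin gamma_integrand_ge0.
Qed.

Lemma ln_GammaD1 x : 0 < x -> ln (Gamma (x + 1)) = ln (Gamma x) + ln x.
Proof. by move=> x0; rewrite GammaD1// lnM ?posrE ?Gamma_gt0// addrC. Qed.

Lemma convex_expR_weighted (s a b : R) : 0 <= s <= 1 ->
  expR (s * a + (1 - s) * b) <= s * expR a + (1 - s) * expR b.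
Proof.
move=> s01.
have := @convex_expR R (Itv01 (proj1 (andP s01)) (proj2 (andP s01))) a b.
by rewrite !convRE/= /unstable.onem.
Qed.

Lemma gamma_integrandE x t : 0 < t ->
  gamma_integrand x t = expR ((x - 1) * ln t - t).
Proof. by move=> t0; rewrite /gamma_integrand /powR gt_eqF// expRD. Qed.

(* Hoelder's inequality for the conjugate exponents [1 / s] and
   [1 / (1 - s)], in the normalised form of Young's inequality. *)
Lemma eGamma_hoelder (s a b A B : R) : 0 <= s <= 1 -> 0 < A -> 0 < B ->
  eGamma a = A%:E -> eGamma b = B%:E ->
  (eGamma (s * a + (1 - s) * b) <= (expR (s * ln A + (1 - s) * ln B))%:E)%E.
Proof.
move=> s01 A0 B0 eA eB; have /andP[s0 s1] := s01.
set M := s * ln A + _.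
(* These are the Young weights [s] and [1 - s] applied to the integrands divided by their integrals
   [A] and [B], rescaled so that the bound integrates to exactly [expR M]. *)
pose ca := expR M * (s / A).
pose cb := expR M * ((1 - s) / B).
have ca0 : 0 <= ca by rewrite mulr_ge0 ?expR_ge0// divr_ge0// ltW.
have cb0 : 0 <= cb by rewrite mulr_ge0 ?expR_ge0// divr_ge0 ?subr_ge0// ltW.
have ME : expR M = ca * A + cb * B.
  by rewrite /ca /cb; field; rewrite !gt_eqF.
rewrite [in leRHS]ME EFinD !EFinM -eA -eB /eGamma.
rewrite -!ge0_integralZl_EFin//; last 4 first.
- by move=> t _; rewrite lee_fin gamma_integrand_ge0.
- exact: measurable_gamma_integrandE.
- by move=> t _; rewrite lee_fin gamma_integrand_ge0.
- exact: measurable_gamma_integrandE.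
have mZ (c x : R) (D : set R) :
    measurable_fun D (fun t => c%:E * (gamma_integrand x t)%:E)%E.
  by apply: emeasurable_funM => //; exact: measurable_gamma_integrandE.
rewrite -ge0_integralD//; last 4 first.
- by move=> t _; rewrite -EFinM lee_fin mulr_ge0// gamma_integrand_ge0.
- exact: mZ.
- by move=> t _; rewrite -EFinM lee_fin mulr_ge0// gamma_integrand_ge0.
- exact: mZ.
apply: ge0_le_integral => //.
- by move=> t _; rewrite lee_fin gamma_integrand_ge0.
- exact: measurable_gamma_integrandE.
- by apply: emeasurable_funD; exact: mZ.
move=> t; rewrite /= in_itv/= andbT => t0.
rewrite -!EFinM -EFinD lee_fin !gamma_integrandE//.
(* The integrand is [expR M] times a weighted geometric mean of the normalised integrands; convexity
   of exp bounds it by the arithmetic mean. *)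
have -> : (s * a + (1 - s) * b - 1) * ln t - t =
    M + (s * ((a - 1) * ln t - t - ln A) +
         (1 - s) * ((b - 1) * ln t - t - ln B)) by rewrite /M; ring.
rewrite [leLHS]expRD.
apply: (le_trans (ler_wpM2l (expR_ge0 M) (convex_expR_weighted _ _ s01))).
rewrite !(expRD (_ - _) (- ln _)) !expRN !lnK ?posrE//.
by rewrite le_eqVlt; apply/orP; left; apply/eqP; rewrite /ca /cb; ring.
Qed.

Lemma ln_Gamma_convex (s a b : R) : 0 <= s <= 1 -> 0 < a -> 0 < b ->
  ln (Gamma (s * a + (1 - s) * b)) <= s * ln (Gamma a) + (1 - s) * ln (Gamma b).
Proof.
move=> s01 a0 b0; have /andP[s0 s1] := s01.
have z0 : 0 < s * a + (1 - s) * b.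
  have [->|sn1] := eqVneq s 1; first by rewrite mul1r subrr mul0r addr0.
  rewrite ltr_wpDl ?mulr_ge0 ?(ltW a0)// mulr_gt0// subr_gt0 lt_neqAle sn1.
  exact: s1.
have := eGamma_hoelder s01 (Gamma_gt0 a0) (Gamma_gt0 b0)
  (esym (EFin_Gamma a0)) (esym (EFin_Gamma b0)).
by rewrite -(EFin_Gamma z0) lee_fin -ler_expR lnK ?posrE ?Gamma_gt0.
Qed.

End GammaIntegral.

(** * From Jensen gaps to the Gamma ratio *)

Lemma prod_powR_div_expR (R : realType) (n : nat) (p : 'I_n -> R)
    (u : 'I_n -> R) (v : R) : (forall k, 0 < u k) -> 0 < v ->
  (\prod_(k < n) u k `^ p k) / v = expR (\sum_(k < n) p k * ln (u k) - ln v).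
Proof.
move=> u0 v0; rewrite expRD expRN lnK ?posrE// expR_sum; congr (_ / _).
by apply: eq_bigr => k _; rewrite /powR gt_eqF.
Qed.

(* By the Bohr-Mollerup theorem these hypotheses determine [Gamma] up to a
   positive constant factor. *)
Section GammaRatio.
Context {R : realType} (G : R -> R).
Hypothesis G_gt0 : forall t : R, 0 < t -> 0 < G t.
Hypothesis G_step : forall t : R, 0 < t -> ln (G (t + 1)) = ln (G t) + ln t.
Hypothesis G_convex : forall s a b : R, 0 <= s <= 1 -> 0 < a -> 0 < b ->
  ln (G (s * a + (1 - s) * b)) <= s * ln (G a) + (1 - s) * ln (G b).

(** The function F of the strategy with [G] for Gamma; [c] is to be [beta - alpha]. *)
Definition log_remainder (b c t : R) : R := ln (G (t + b)) - (t + c) * ln t.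

Lemma log_remainder_step (b c t : R) : 0 < b -> 0 < t ->
  log_remainder b c t - log_remainder b c (t + 1) = gamma_step b c t.
Proof.
move=> b0 t0; rewrite /log_remainder /gamma_step.
by rewrite (addrAC t 1 b) G_step ?addr_gt0//; ring.
Qed.

Lemma cvg_log_remainder (b c t : R) : 0 < t ->
  log_remainder b c (t + N%:R)
    - ((ln (G (N%:R + b)) - (N%:R + c) * ln N%:R) + (- 1) * t) @[N --> \oo] --> 0.
Proof.
move=> t0.
exact: (cvg_log_convex_affine (L := fun t => ln (G t)) G_step G_convex b c t0).
Qed.

Section Jensen.
Context (n : nat) (x p : 'I_n -> R) (alpha beta : R).
Hypotheses (x_gt0 : forall k, 0 < x k) (p_ge0 : forall k, 0 <= p k).
Hypothesis sum_p : \sum_(k < n) p k = 1.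

Lemma jensen_gap_log_remainder_ge0 :
  (0 < beta /\ alpha <= 0) \/ (1 <= beta /\ alpha <= 2^-1) ->
  0 <= jensen_gap x p (log_remainder beta (beta - alpha)).
Proof.
move=> hab; have b0 : 0 < beta by case: hab => -[]; lra.
apply: (jensen_gap_ge0_telescope p_ge0 sum_p _ _ x_gt0); last first.
  exact: cvg_log_remainder.
move=> y y0; rewrite (eq_jensen_gap p_ge0 sum_p y0
  (fun t => @log_remainder_step _ _ t b0)).
apply: (jensen_gap_ge0 p_ge0 sum_p _ _ _ y0).
- by move=> t t0; apply: is_derive_gamma_step; rewrite ?addr_gt0.
- by move=> t t0; apply: is_derive_gamma_step1; rewrite ?addr_gt0.
- by move=> t t0; exact: gamma_step2_ge0.
Qed.

(** The telescoping argument runs on the negated remainder, whose asymptotic slope is therefore 1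
    instead of -1. *)
Lemma jensen_gap_log_remainder_le0 : beta <= alpha -> 2^-1 <= beta ->
  jensen_gap x p (log_remainder beta (beta - alpha)) <= 0.
Proof.
move=> ab hb; have b0 : 0 < beta by lra.
rewrite -oppr_ge0 -jensen_gapN.
apply: (jensen_gap_ge0_telescope p_ge0 sum_p (a := fun N =>
  - (ln (G (N%:R + beta)) - (N%:R + (beta - alpha)) * ln N%:R))
  (b := fun=> 1) _ _ x_gt0); last first.
  move=> t /(cvg_log_remainder beta (beta - alpha)) /cvgN; rewrite oppr0.
  apply: cvg_trans; apply: near_eq_cvg; apply: nearW => N.
  by rewrite fctE; ring.
move=> y y0; rewrite (@eq_jensen_gap _ _ _ p_ge0 sum_p _ _
    (fun t => - gamma_step beta (beta - alpha) t) y0); last first.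
  by move=> t t0; rewrite -(log_remainder_step _ b0 t0); ring.
apply: (jensen_gap_ge0 p_ge0 sum_p _ _ _ y0).
- move=> t t0; apply: is_deriveN.
  by apply: is_derive_gamma_step; rewrite ?addr_gt0.
- move=> t t0; apply: is_deriveN.
  by apply: is_derive_gamma_step1; rewrite ?addr_gt0.
- by move=> t t0; rewrite oppr_ge0; exact: gamma_step2_le0.
Qed.

(** The quotient of the two sides of the claim is exactly the exponential of a Jensen gap, so the
    sign of the gap decides both directions. *)
Lemma log_remainder_ratio : 0 < beta ->
  (\prod_(k < n) (G (x k + beta) `^ p k))
    / G (\sum_(k < n) (p k * x k) + beta) =
  expR (jensen_gap x p (log_remainder beta (beta - alpha))) *
  ((\prod_(k < n) (x k `^ (p k * (x k + beta - alpha))))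
    / (\sum_(k < n) (p k * x k)) `^ (\sum_(k < n) (p k * x k) + beta - alpha)).
Proof.
move=> b0; have m0 := mean_gt0 p_ge0 sum_p x_gt0.
(* Viewing each factor as a [p k]-th power gives both products the same form, so that one lemma
   takes both logarithms. *)
under [X in _ = _ * (X / _)]eq_bigr do rewrite mulrC powRrM.
rewrite !prod_powR_div_expR//; last 4 first.
- by move=> k; rewrite powR_gt0.
- by rewrite powR_gt0.
- by move=> k; rewrite G_gt0// addr_gt0.
- by rewrite G_gt0// addr_gt0.
rewrite -expRD; congr expR.
rewrite jensen_gapD jensen_gapN /jensen_gap ln_powR -addrA.
under [X in _ = _ + (_ + (X - _))]eq_bigr do rewrite ln_powR -addrA.
ring.
Qed.

Lemma powR_le_Gamma_ratio :
  (0 < beta /\ alpha <= 0) \/ (1 <= beta /\ alpha <= 2^-1) ->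
  (\prod_(k < n) (x k `^ (p k * (x k + beta - alpha))))
    / (\sum_(k < n) (p k * x k)) `^ (\sum_(k < n) (p k * x k) + beta - alpha)
  <= (\prod_(k < n) (G (x k + beta) `^ p k))
    / G (\sum_(k < n) (p k * x k) + beta).
Proof.
move=> hab; have b0 : 0 < beta by case: hab => -[]; lra.
rewrite log_remainder_ratio// ler_peMl//.
  by rewrite divr_ge0 ?powR_ge0// prodr_ge0// => k _; rewrite powR_ge0.
by rewrite -expR0 ler_expR jensen_gap_log_remainder_ge0.
Qed.

Lemma Gamma_ratio_le_powR : beta <= alpha -> 2^-1 <= beta ->
  (\prod_(k < n) (G (x k + beta) `^ p k))
    / G (\sum_(k < n) (p k * x k) + beta)
  <= (\prod_(k < n) (x k `^ (p k * (x k + beta - alpha))))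
    / (\sum_(k < n) (p k * x k)) `^ (\sum_(k < n) (p k * x k) + beta - alpha).
Proof.
move=> ab hb; have b0 : 0 < beta by lra.
rewrite log_remainder_ratio// ler_piMl//.
  by rewrite divr_ge0 ?powR_ge0// prodr_ge0// => k _; rewrite powR_ge0.
by rewrite -expR0 ler_expR jensen_gap_log_remainder_le0.
Qed.

End Jensen.
End GammaRatio.

Theorem theorem4 (R : realType) (n : nat) (hn : (1 <= n)%N)
    (x p : 'I_n -> R)
    (hx : forall k, 0 < x k)
    (hp : forall k, 0 <= p k)
    (hp1 : \sum_(k < n) p k = 1)
    (alpha beta : R) :
  ((0 < beta /\ alpha <= 0) \/ (1 <= beta /\ alpha <= 2^-1) ->
     (\prod_(k < n) (Gamma (x k + beta) `^ p k))
       / Gamma (\sum_(k < n) (p k * x k) + beta)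
     >= (\prod_(k < n) (x k `^ (p k * (x k + beta - alpha))))
       / (\sum_(k < n) (p k * x k))
           `^ (\sum_(k < n) (p k * x k) + beta - alpha))
  /\
  (alpha >= beta /\ beta >= 2^-1 ->
     (\prod_(k < n) (Gamma (x k + beta) `^ p k))
       / Gamma (\sum_(k < n) (p k * x k) + beta)
     <= (\prod_(k < n) (x k `^ (p k * (x k + beta - alpha))))
       / (\sum_(k < n) (p k * x k))
           `^ (\sum_(k < n) (p k * x k) + beta - alpha)).
Proof.
split=> [hab|[ab hb]].
- exact: (powR_le_Gamma_ratio (@Gamma_gt0 R) (@ln_GammaD1 R)
    (@ln_Gamma_convex R) hx hp hp1 hab).
- exact: (Gamma_ratio_le_powR (@Gamma_gt0 R) (@ln_GammaD1 R)
    (@ln_Gamma_convex R) hx hp hp1 ab hb).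
Qed.
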